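(* For any $\langle h\rangle\in\mathfrak{m}_A(0)$ there is a $T>0$ such that $\exp(t\langle h\rangle)\in\mathcal{M}_A(0)$ for all $t\in[0,T)$.
   Context: Matrices are doubly infinite, indexed by $\mathbb{Z}\times\mathbb{Z}$; $A^m_n$ is the entry in row $m$, column $n$. For a formal power series $f(z)=\sum_{n\ge1}a_nz^n$ with $a_1\ne0$, the power matrix $[f]$ has entries given by $f(z)^n=\sum_{k\ge n}[f]^n_kz^k$, $n\in\mathbb{Z}$; $\mathcal{M}(0)$ is the set of all such $[f]$, and $\mathcal{M}_A(0)\subset\mathcal{M}(0)$ is the subset of those $[f]$ for which $f$ is holomorphic (i.e. has positive radius of convergence). For a formal power series $h(z)=\sum_{n\geq1}h_nz^n$ (possibly zero), $\langle h\rangle$ is the matrix with entry $m\,h_{n-m+1}$ in row $m$, column $n$ ($h_j=0$ for $j\le 0$); $\mathfrak{m}(0)$ is the set of all such $\langle h\rangle$, and $\mathfrak{m}_A(0)\subset \mathfrak{m}(0)$ is the subset arising from holomorphic (positive radius of convergence) power series $h$. $\exp$ is the matrix exponential, understood entrywise (the matrices are upper triangular, so products are finite sums and every entry of the exponential converges). *)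

(* Defs.v *)
From HB Require Import structures.
From mathcomp Require Import all_boot all_order all_algebra complex.
From mathcomp Require Import all_classical all_reals all_analysis.
From mathcomp Require Import zify.

Set Implicit Arguments.
Unset Strict Implicit.
Unset Printing Implicit Defensive.

Import Order.TTheory GRing.Theory Num.Theory.
Import numFieldNormedType.Exports.

Local Open Scope classical_set_scope.
Local Open Scope ring_scope.
Local Open Scope complex_scope.

(* [fps K] is K[[z]], a series being its sequence of coefficients. *)
Definition fps (K : fieldType) := nat -> K.

Section FormalPowerSeries.
Variable K : fieldType.
Implicit Types a b f : fps K.

Definition fps_one : fps K := fun n => (n == 0%N)%:R.

Definition fps_mul a b : fps K := fun n => \sum_(i < n.+1) a i * b (n - i)%N.

Definition fps_exp a (k : nat) : fps K := iter k (fps_mul a) fps_one.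

(* The list of the first n coefficients of 1 / a; see fps_mulfV. *)
Fixpoint fps_inv_take a (n : nat) : seq K :=
  if n is n'.+1 then
    let s := fps_inv_take a n' in
    rcons s ((a 0%N)^-1 * ((n' == 0%N)%:R - \sum_(i < n') a (n' - i)%N * s`_i))
  else [::].

Definition fps_inv a : fps K := fun n => (fps_inv_take a n.+1)`_n.

Definition fps_expz a (n : int) : fps K :=
  match n with
  | Posz k => fps_exp a k
  | Negz k => fps_exp (fps_inv a) k.+1
  end.

(* The coefficients of a as a two-sided sequence. *)
Definition coefz a (j : int) : K := if j is Posz k then a k else 0.

(* f(z) / z, for f without constant term. *)
Definition fps_divX f : fps K := fun i => f i.+1.

End FormalPowerSeries.

Section BiinfiniteMatrices.
Variable K : fieldType.

(* A m n is the entry in row m and column n. *)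
Definition bimx := int -> int -> K.

Implicit Types A B : bimx.

Definition bimx_one : bimx := fun m n => (m == n)%:R.

Definition bimx_scale (c : K) A : bimx := fun m n => c * A m n.

(* The sum ranges over the indices k with a nonzero term, and is 0 if there
   are infinitely many of them, which does not happen for upper triangular
   matrices; see bimx_mulE. *)
Definition bimx_mul A B : bimx :=
  fun m n => \sum_(k \in [set: int]) A m k * B k n.

Definition bimx_exp A (k : nat) : bimx := iter k (bimx_mul A) bimx_one.

Definition upper_triangular A := forall m n : int, n < m -> A m n = 0.

(* The power matrix [f]. Row n lists the coefficients of the Laurent series
   f(z)^n = z^n (f(z) / z)^n, where f(z) / z is invertible in K[[z]] since
   f 1 != 0; see power_mxS. *)
Definition power_mx (f : fps K) : bimx :=
  fun n k => coefz (fps_expz (fps_divX f) n) (k - n).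

(* The matrix <h>. *)
Definition bracket_mx (h : fps K) : bimx :=
  fun m n => m%:~R * coefz h (n - m + 1).

End BiinfiniteMatrices.

Section Analytic.
Variable R : realType.

(* The topology of the complex numbers is found on R[i]^o, which is R[i]
   regarded as a normed module over itself. *)
Definition holomorphic_fps (a : fps R[i]) := exists2 r : R, 0 < r &
  forall z : R[i], `|z| < r%:C ->
    cvgn (series (fun n => a n * z ^+ n : R[i]^o)).

Definition MA0 : set (bimx R[i]) :=
  [set A | exists f : fps R[i],
    [/\ f 0%N = 0, f 1%N != 0, holomorphic_fps f & A = power_mx f]].

Definition mA0 : set (bimx R[i]) :=
  [set A | exists h : fps R[i],
    [/\ h 0%N = 0, holomorphic_fps h & A = bracket_mx h]].

Definition bimx_expm_series (A : bimx R[i]) (m n : int) : nat -> R[i]^o :=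
  series (fun k => (k`!%:R)^-1 * bimx_exp A k m n : R[i]^o).

(* The limit exists for upper triangular matrices; see
   cvg_bimx_expm_series. *)
Definition bimx_expm (A : bimx R[i]) : bimx R[i] :=
  fun m n => limn (bimx_expm_series A m n).

End Analytic.

Section AlgebraicFacts.
Variable K : fieldType.
Implicit Types (a b f : fps K) (A B : bimx K).

Lemma size_fps_inv_take a n : size (fps_inv_take a n) = n.
Proof. by elim: n => //= n IH; rewrite size_rcons IH. Qed.

Lemma nth_fps_inv_take a n i : (i < n)%N -> (fps_inv_take a n)`_i = fps_inv a i.
Proof.
elim: n => // n IH; rewrite ltnS leq_eqVlt => /orP[/eqP -> //|lt_in].
by rewrite -(IH lt_in) /= nth_rcons size_fps_inv_take lt_in.
Qed.

Lemma fps_invE a n : fps_inv a n =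
  (a 0%N)^-1 * ((n == 0%N)%:R - \sum_(i < n) a (n - i)%N * fps_inv a i).
Proof.
rewrite {1}/fps_inv /= nth_rcons size_fps_inv_take ltnn eqxx.
by under eq_bigr do rewrite nth_fps_inv_take //.
Qed.

Lemma fps_mulC a b : fps_mul a b = fps_mul b a.
Proof.
apply/funext => n; rewrite /fps_mul (reindex_inj rev_ord_inj) /=.
by apply: eq_bigr => i _; rewrite mulrC subSS subKn // -ltnS.
Qed.

Lemma fps_mulfV a : a 0%N != 0 -> fps_mul a (fps_inv a) = fps_one K.
Proof.
move=> a0; rewrite fps_mulC; apply/funext => n; rewrite /fps_mul big_ord_recr /= subnn.
rewrite [X in _ + X * _]fps_invE mulrAC mulVf // mul1r addrC.
under [X in _ + X]eq_bigr do rewrite mulrC.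
by rewrite subrK.
Qed.

Lemma fps_mul_poly a b n N : (n < N)%N ->
  fps_mul a b n = ((\poly_(i < N) a i) * (\poly_(i < N) b i))`_n.
Proof.
move=> nN; rewrite coefM; apply: eq_bigr => i _; rewrite !coef_poly.
by rewrite !ifT //; [apply: leq_ltn_trans nN; apply: leq_subr|apply: leq_trans nN; apply: ltn_ord].
Qed.

Lemma fps_mulA a b c : fps_mul a (fps_mul b c) = fps_mul (fps_mul a b) c.
Proof.
apply/funext => n.
pose p x := \poly_(i < n.+1) (x : fps K) i.
transitivity ((p a * (p b * p c))`_n).
  rewrite coefM; apply: eq_bigr => i _; rewrite coef_poly ltn_ord; congr (_ * _).
  by rewrite (@fps_mul_poly _ _ _ n.+1) // ltnS leq_subr.
rewrite mulrA coefM; apply: eq_bigr => i _.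
by rewrite [(p c)`__]coef_poly ltnS leq_subr (@fps_mul_poly _ _ _ n.+1).
Qed.

Lemma fps_mul1 a : fps_mul (fps_one K) a = a.
Proof.
apply/funext => n; rewrite /fps_mul big_ord_recl /= /fps_one eqxx mul1r subn0.
by rewrite big1 ?addr0 // => i _; rewrite mul0r.
Qed.

Lemma fps_expzS a (n : int) : a 0%N != 0 ->
  fps_expz a (n + 1) = fps_mul a (fps_expz a n).
Proof.
move=> a0; case: n => [n|n].
  by rewrite (_ : Posz n + 1 = Posz n.+1) ?addn1 //; rewrite -PoszD addn1.
rewrite NegzE -addn1 PoszD opprD addrNK.
rewrite (_ : - n%:Z - 1 = Negz n); last by rewrite NegzE -addn1 PoszD opprD.
rewrite [in RHS]/fps_expz /fps_exp [iter n.+1 _ _]iterS fps_mulA fps_mulfV // fps_mul1.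
by case: n => [|n] //; rewrite -NegzE.
Qed.

Lemma power_mx0 f n : power_mx f 0 n = (n == 0)%:R.
Proof. by rewrite /power_mx subr0; case: n => [[]|]. Qed.


Lemma bimx_mulE A B (m : int) (d : nat) :
  upper_triangular A -> upper_triangular B ->
  bimx_mul A B m (m + d%:Z) =
  \sum_(i < d.+1) A m (m + i%:Z) * B (m + i%:Z) (m + d%:Z).
Proof.
move=> uA uB; pose r := [seq m + i%:Z | i <- iota 0 d.+1].
rewrite /bimx_mul; transitivity (\sum_(k <- r) A m k * B k (m + d%:Z)).
  have ur : uniq r by rewrite map_inj_uniq ?iota_uniq // => i j; lia.
rewrite (fsbig_seq _ _ ur).
  apply/esym/fsbig_widen => // k [_ /= kr].
  have [km|mk] := ltP k m; first by rewrite uA ?mul0r.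
  have [nk|kn] := ltP (m + d%:Z) k; first by rewrite uB ?mulr0.
  by case: kr; apply/mapP; exists (absz (k - m)%R); rewrite ?mem_iota; lia.
by rewrite big_map -[iota _ _]/(index_iota 0 d.+1) big_mkord.
Qed.

Lemma upper_triangular_mul A B :
  upper_triangular A -> upper_triangular B -> upper_triangular (bimx_mul A B).
Proof.
move=> uA uB m n nm; rewrite /bimx_mul fsbig1 // => k _.
have [km|mk] := ltP k m; first by rewrite uA ?mul0r.
by rewrite uB ?mulr0 // (lt_le_trans nm).
Qed.

Lemma upper_triangular_exp A k :
  upper_triangular A -> upper_triangular (bimx_exp A k).
Proof.
move=> uA; elim: k => [|k IH]; last exact: upper_triangular_mul.
by move=> m n nm; rewrite /bimx_exp /bimx_one /= gt_eqF.
Qed.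

Lemma upper_triangular_bracket h : h 0%N = 0 -> upper_triangular (bracket_mx (h : fps K)).
Proof.
move=> h0 m n nm; rewrite /bracket_mx.
have [->|j0] := eqVneq (n - m + 1) 0; first by rewrite /= h0 mulr0.
have : (n - m + 1 < 0) by lia.
by case: (n - m + 1) => //= j _; rewrite mulr0.
Qed.

Lemma upper_triangular_scale c A :
  upper_triangular A -> upper_triangular (bimx_scale c A).
Proof. by move=> uA m n nm; rewrite /bimx_scale uA ?mulr0. Qed.

Lemma coefz_lt0 a (j : int) : j < 0 -> coefz a j = 0.
Proof. by case: j. Qed.

Lemma upper_triangular_power f : upper_triangular (power_mx f).
Proof. by move=> m n nm; rewrite /power_mx coefz_lt0 // subr_lt0. Qed.

(* f(z)^(n+1) = f(z) f(z)^n, as Laurent series. *)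
Lemma power_mxS f (n k : int) : f 0%N = 0 -> f 1%N != 0 ->
  power_mx f (n + 1) k = \sum_(j \in [set: int]) coefz f j * power_mx f n (k - j).
Proof.
move=> f0 f1; have [kn|nk] := ltP k (n + 1).
  rewrite upper_triangular_power // fsbig1 // => j _.
  have [j0|j0] := leP j 0.
    rewrite (_ : coefz f j = 0) ?mul0r //.
    by case: j j0 => [[|i]|i].
  by rewrite upper_triangular_power ?mulr0 //; lia.
have [d ->] : exists d : nat, k = n + 1 + d%:Z by exists (absz (k - n - 1)%R); lia.
rewrite /power_mx fps_expzS // [n + 1 + _ - _]addrC addKr /=.
pose r := [seq i.+1%:Z | i <- iota 0 d.+1].
transitivity (\sum_(j <- r) coefz f j * power_mx f n (n + 1 + d%:Z - j)).
  rewrite big_map -[iota _ _]/(index_iota 0 d.+1) big_mkord /fps_mul /power_mx.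
  apply: eq_bigr => i _; rewrite (_ : _ - n = (d - i)%N%:Z) //; have := ltn_ord i; lia.
have ur : uniq r by rewrite map_inj_uniq ?iota_uniq // => i j; lia.
rewrite (fsbig_seq _ _ ur).
apply: fsbig_widen => // j [_ /= jr].
have [j0|j0] := leP j 0.
  rewrite (_ : coefz f j = 0) ?mul0r //.
  by case: j {jr} j0 => [[|i]|i].
rewrite upper_triangular_power ?mulr0 // ltNge; apply: contra_notN jr => jd.
by apply/mapP; exists (absz (j - 1)%R); rewrite ?mem_iota; lia.
Qed.
End AlgebraicFacts.

Section ExponentialConverges.
Variable R : realType.

Lemma complex_norm_ReIm (z : R[i]) :
  [/\ (`|complex.Re z|%:C <= `|z|), (`|complex.Im z|%:C <= `|z|) & `|z| <= (`|complex.Re z| + `|complex.Im z|)%:C].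
Proof.
case: z => a b; rewrite !normc_def /= !lecR -[`|a|]sqrtr_sqr -[`|b|]sqrtr_sqr.
rewrite !ler_wsqrtr ?lerDl ?lerDr ?sqr_ge0 //; split => //.
rewrite -[leRHS]ger0_norm ?addr_ge0 ?sqrtr_ge0 // -[leRHS]sqrtr_sqr ler_wsqrtr //.
rewrite sqrrD !sqr_sqrtr ?sqr_ge0 // addrAC lerDl.
by rewrite mulrn_wge0 // mulr_ge0 ?sqrtr_ge0.
Qed.

Lemma cvg_series_complex (u : nat -> R[i]^o) (v : nat -> R) :
  (forall n, `|u n| <= (v n)%:C) -> cvgn (series v) -> cvgn (series u).
Proof.
move=> uv cv.
have key (g : R[i] -> R) : (forall z, `|g z|%:C <= `|z|) ->
    cvgn (series (fun n => g (u n))).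
  move=> hg; apply: normed_cvg.
  apply: (series_le_cvg _ _ _ cv) => n //=.
  - by rewrite -lecR; apply: le_trans (uv n); exact: normr_ge0.
  - by rewrite -lecR; exact: le_trans (hg _) (uv n).
have /cvg_ex[/= a ca] := key _ (fun z => let: And3 h _ _ := complex_norm_ReIm z in h).
have /cvg_ex[/= b cb] := key _ (fun z => let: And3 _ h _ := complex_norm_ReIm z in h).
apply/cvg_ex; exists (a +i* b : R[i]^o).
apply/cvgrPdist_lt => /= e; case: e => e e'; rewrite ltcE /= => /andP[/eqP -> e0].
have e20 : 0 < e / 2 by rewrite divr_gt0.
near=> n.
have [_ _ /le_lt_trans] := complex_norm_ReIm (a +i* b - series u n); apply.
have seriesE : series u n = (series (fun n => complex.Re (u n)) n +i* series (fun n => complex.Im (u n)) n).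
  rewrite /series /=; elim: (n) => [|k IH]; first by rewrite !big_geq.
  by rewrite !big_nat_recr //= IH; case: (u k).
rewrite seriesE ltcR /= [e]splitr ltrD //; near: n.
- by move/cvgrPdist_lt : ca; apply.
- by move/cvgrPdist_lt : cb; apply.
Unshelve. all: by end_near.
Qed.

Lemma cvg_bimx_expm_series (A : bimx R[i]) (m n : int) :
  upper_triangular A -> cvgn (bimx_expm_series A m n).
Proof.
move=> uA; have [nm|mn] := ltP n m.
  apply: (@cvg_series_complex _ (fun=> 0)) => [k|].
    by rewrite upper_triangular_exp // mulr0 normr0.
  by rewrite (_ : series _ = cst 0); [exact: is_cvg_cst|apply/funext => k; rewrite /series /= big1].
have [d ->] : exists d : nat, n = m + d%:Z by exists (absz (n - m)%R); lia.
have normE (z : R[i]) : `|z| = (complex.Re `|z|)%:C by rewrite normc_def.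
pose B : R := \sum_(i < d.+1) \sum_(j < d.+1) complex.Re `|A (m + i%:Z) (m + j%:Z)|.
have N0 (z : R[i]) : 0 <= complex.Re `|z| by rewrite -lecR -normE; exact: normr_ge0.
have B0 : 0 <= B by do 2! apply: sumr_ge0 => ? _.
have AB (i j : nat) : (i <= d)%N -> (j <= d)%N -> `|A (m + i%:Z) (m + j%:Z)| <= B%:C.
  move=> id jd; rewrite normE lecR /B.
  rewrite (bigD1 (inord i)) //= (bigD1 (inord j)) //= !inordK //.
  have N1 (z : R[i]) : 0 <= Normc.normc z := N0 z.
  rewrite -addrA lerDl addr_ge0 //; first by apply: sumr_ge0.
  by do 2! apply: sumr_ge0 => ? _.
pose c := d.+1%:R * B.
have c0 : 0 <= c by rewrite mulr_ge0.
have bound k (i j : nat) : (i <= d)%N -> (j <= d)%N ->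
    `|bimx_exp A k (m + i%:Z) (m + j%:Z)| <= (c ^+ k)%:C.
  elim: k i j => [|k IH] i j id jd.
    rewrite /bimx_exp /= /bimx_one expr0.
    by case: (_ == _); rewrite ?normr1 // normr0 lecR.
  have [ji|ij] := ltnP j i.
    by rewrite upper_triangular_exp // ?normr0 ?lecR ?exprn_ge0 //; lia.
  rewrite /bimx_exp iterS -/(bimx_exp A k) (_ : m + j%:Z = m + i%:Z + (j - i)%N%:Z); last by lia.
  rewrite bimx_mulE //; last exact: upper_triangular_exp.
  apply: le_trans (ler_norm_sum _ _ _) _.
  apply: (@le_trans _ _ (\sum_(l < (j - i).+1) (B * c ^+ k)%:C)).
    apply: ler_sum => l _; rewrite normrM rmorphM.
    have := ltn_ord l => lj.
    rewrite -!addrA -!PoszD; apply: ler_pM => //; first by apply: AB => //; lia.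
    by apply: IH; lia.
  rewrite sumr_const card_ord -rmorphMn lecR -mulr_natl exprS mulrA.
  by rewrite ler_wpM2r ?exprn_ge0 // ler_wpM2r // ler_nat; lia.
apply: (@cvg_series_complex _ (exp_coeff c)) => [k|]; last exact: is_cvg_series_exp_coeff.
rewrite normrM /exp_coeff /= mulrC rmorphM; apply: ler_pM => //.
  by have := @bound k 0 d; rewrite addr0; apply.
by rewrite normfV normr_nat fmorphV rmorph_nat.
Qed.
End ExponentialConverges.

(* Main.v *)
Require Import Defs.
From mathcomp Require Import all_boot all_order all_algebra complex.
From mathcomp Require Import all_classical all_reals all_analysis.
From mathcomp Require Import zify ring.
Import Order.TTheory GRing.Theory Num.Theory.
Import numFieldNormedType.Exports.
Local Open Scope classical_set_scope.
Local Open Scope ring_scope.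
Local Open Scope complex_scope.

(* Let D = h d/dz.  Row m of <h>^k lists the coefficients of D^k z^m, so row m of
   exp <h> is the series exp(D) z^m.  As D is a derivation, exp(D) is
   multiplicative, hence exp <h> = [f] with f = exp(D) z; multiplicativity comes
   from Leibniz' rule for D^k / k! and the Cauchy product of the exponential
   series.  If |h_(n+1)| <= M rho^n, comparison with the derivation
   M (1 - rho z)^-1 d/dz bounds the coefficient of z^(n+1) in D^k z / k! by
   (8 M)^k (2 rho)^n.  Replacing h by t h makes the sum over k converge
   geometrically once 16 t M < 1, with a bound O((2 rho)^n). *)

(** * Finite windows of upper triangular matrices *)

Section UpperTriangular.
Context {K : fieldType}.
Implicit Types A B : bimx K.

(** Passing to a finite diagonal block makes the ring structure of ['M[K]_N] available. *)
Definition bimx_window A (m : int) (N : nat) : 'M[K]_N :=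
  \matrix_(i, j) A (m + i%:Z) (m + j%:Z).

(** In the sum for entry (i, j) only the indices between i and j contribute, and these all lie in
    the window. *)
Lemma bimx_window_mul A B m N : upper_triangular A -> upper_triangular B ->
  bimx_window (bimx_mul A B) m N = bimx_window A m N *m bimx_window B m N.
Proof.
move=> uA uB; apply/matrixP => i j; rewrite !mxE.
have [ji|ij] := ltnP j i.
  rewrite upper_triangular_mul //; last by lia.
  rewrite big1 // => k _; rewrite !mxE.
  have [ki|ik] := ltnP k i; first by rewrite uA ?mul0r //; lia.
  by rewrite uB ?mulr0 //; lia.
have -> : m + j%:Z = m + i%:Z + (j - i)%N%:Z by lia.
rewrite bimx_mulE //.
have jN := ltn_ord j.
rewrite -(big_mkord xpredT (fun l => A (m + i%:Z) (m + i%:Z + l%:Z) *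
  B (m + i%:Z + l%:Z) (m + i%:Z + (j - i)%N%:Z))).
have -> : \sum_(k < N) bimx_window A m N i k * bimx_window B m N k j =
    \sum_(0 <= k < N) A (m + i%:Z) (m + k%:Z) * B (m + k%:Z) (m + j%:Z).
  by rewrite big_mkord; apply: eq_bigr => k _; rewrite !mxE.
have le1 : (i <= j.+1)%N by lia.
rewrite (@big_cat_nat _ _ _ i 0 N) //=; last exact: ltnW.
rewrite (@big_cat_nat _ _ _ j.+1 i N) //=.
symmetry; rewrite big_nat_cond big1 ?add0r; last first.
  by move=> k /andP[/andP[_ ki] _]; rewrite uA ?mul0r //; lia.
rewrite [X in _ + X]big_nat_cond [X in _ + X]big1 ?addr0; last first.
  by move=> k /andP[/andP[jk _] _]; rewrite uB ?mulr0 //; lia.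
rewrite -{1}[nat_of_ord i]add0n big_addn subSn //; apply: eq_bigr => k _.
have -> : m + (k + i)%N%:Z = m + i%:Z + k%:Z by lia.
by have -> : m + i%:Z + (j - i)%N%:Z = m + j%:Z by lia.
Qed.

(** [bimx_exp] multiplies on the left, whereas one more application of D to a row is a
    multiplication on the right. Inside a window both agree by [exprSr]. *)
Lemma bimx_expSr A k (m : int) (d : nat) : upper_triangular A ->
  bimx_exp A k.+1 m (m + d%:Z) = bimx_mul (bimx_exp A k) A m (m + d%:Z).
Proof.
move=> uA.
have winE k' : bimx_window (bimx_exp A k') m d.+1 = (bimx_window A m d.+1) ^+ k'.
  elim: k' => [|k' IH].
    by apply/matrixP => i j; rewrite expr0 !mxE /bimx_exp /= /bimx_one (inj_eq (addrI m)).
  rewrite exprS -IH -[RHS]bimx_window_mul //; exact: upper_triangular_exp.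
have /matrixP/(_ ord0 ord_max) : bimx_window (bimx_exp A k.+1) m d.+1 =
    bimx_window (bimx_mul (bimx_exp A k) A) m d.+1.
  rewrite bimx_window_mul //; last exact: upper_triangular_exp.
  by rewrite !winE exprSr.
by rewrite !mxE /= addr0.
Qed.

End UpperTriangular.

(** * The derivation D and Leibniz' rule for its divided powers *)

Section TwistedDerivation.
Context {K : fieldType}.
Variable g : fps K.
Implicit Types a b : fps K.

(* With h = z g and D = h d/dz, one has D(z^m a) = z^m (twisted_der m a). *)
Definition twisted_der (m : int) a : fps K :=
  fps_mul g (fun j => (m + j%:Z)%:~R * a j).

Lemma fps_mulDl a b c n :
  fps_mul (fun j => a j + b j) c n = fps_mul a c n + fps_mul b c n.
Proof. by rewrite /fps_mul -big_split; apply: eq_bigr => i _; rewrite mulrDl. Qed.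

Lemma fps_mulDr a b c n :
  fps_mul c (fun j => a j + b j) n = fps_mul c a n + fps_mul c b n.
Proof. by rewrite !(fps_mulC c) fps_mulDl. Qed.

Lemma fps_mulZr (c : K) a b n :
  fps_mul a (fun j => c * b j) n = c * fps_mul a b n.
Proof. by rewrite /fps_mul mulr_sumr; apply: eq_bigr => i _; rewrite mulrCA. Qed.

Lemma fps_mulZl (c : K) a b n :
  fps_mul (fun j => c * a j) b n = c * fps_mul a b n.
Proof. by rewrite !(fps_mulC _ b) fps_mulZr. Qed.

Lemma fps_mul_sumr I (r : seq I) (P : pred I) (F : I -> fps K) a n :
  fps_mul a (fun j => \sum_(i <- r | P i) F i j) n =
  \sum_(i <- r | P i) fps_mul a (F i) n.
Proof.
rewrite /fps_mul exchange_big; apply: eq_bigr => i _ /=.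
by rewrite mulr_sumr.
Qed.

Lemma twisted_derZ m (c : K) a n :
  twisted_der m (fun j => c * a j) n = c * twisted_der m a n.
Proof.
rewrite /twisted_der -fps_mulZr; congr (fps_mul _ _ _).
by apply/funext => j; rewrite mulrCA.
Qed.

Lemma twisted_der_sum m I (r : seq I) (P : pred I) (F : I -> fps K) n :
  twisted_der m (fun j => \sum_(i <- r | P i) F i j) n =
  \sum_(i <- r | P i) twisted_der m (F i) n.
Proof.
rewrite /twisted_der -fps_mul_sumr; congr (fps_mul _ _ _).
by apply/funext => j; rewrite mulr_sumr.
Qed.

(** Leibniz' rule for D on z^m a and z^l b: the weight m + l + j splits as (m + i) + (l + (j -
    i)). *)
Lemma twisted_derM (m l : int) a b n :
  twisted_der (m + l) (fps_mul a b) n =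
  fps_mul (twisted_der m a) b n + fps_mul a (twisted_der l b) n.
Proof.
rewrite /twisted_der [fps_mul a (fps_mul _ _)]fps_mulA [fps_mul a g]fps_mulC.
rewrite -!fps_mulA -fps_mulDr; congr (fps_mul _ _ _); apply/funext => j.
rewrite /fps_mul mulr_sumr -big_split; apply: eq_bigr => i _ /=.
have -> : m + l + j%:Z = (m + i%:Z) + (l + (j - i)%N%:Z).
  by have := ltn_ord i; lia.
by rewrite rmorphD /=; ring.
Qed.

(* The k-th Taylor coefficient in t of z^-m exp(t D) z^m. *)
Definition flow_coef (m : int) (k : nat) : fps K :=
  fun n => (k`!%:R)^-1 * iter k (twisted_der m) (fps_one K) n.

Lemma flow_coef0 k n : flow_coef 0 k n = ((k == 0%N) && (n == 0%N))%:R.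
Proof.
rewrite /flow_coef; case: k => [|k]; first by rewrite /= fact0 invr1 mul1r.
rewrite (_ : iter k.+1 _ _ n = 0) ?mulr0 //.
have zero j : twisted_der 0 (fun=> 0) j = 0.
  by rewrite /twisted_der /fps_mul big1 // => i _; rewrite !mulr0.
elim: k n => [|k IH] n.
  rewrite /= /twisted_der /fps_mul big1 // => i _; rewrite /fps_one.
  by case: (n - i)%N => [|j]; rewrite ?mul0r ?mulr0 ?mulr0.
rewrite iterS (_ : iter k.+1 _ _ = fun=> 0) //; exact/funext.
Qed.

Hypothesis charK : [pchar K] =i pred0.

Lemma flow_coefS m k n :
  k.+1%:R * flow_coef m k.+1 n = twisted_der m (flow_coef m k) n.
Proof.
rewrite /flow_coef twisted_derZ iterS factS natrM invfM 2!mulrA divff ?mul1r //.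
by rewrite ((pcharf0P K).1 charK).
Qed.

(** This is exp(t D)(z^m z^l) = exp(t D) z^m exp(t D) z^l, compared at t^k. Both sides satisfy the
    same recursion in k, by [flow_coefS] and Leibniz' rule. *)
Lemma flow_coefD m l k n :
  flow_coef (m + l) k n =
  \sum_(i < k.+1) fps_mul (flow_coef m i) (flow_coef l (k - i)) n.
Proof.
elim: k n => [|k IH] n.
  rewrite big_ord1 /flow_coef /= !fact0 invr1.
  rewrite fps_mulZl fps_mulZr !mul1r.
  by rewrite fps_mul1.
have k0 : k.+1%:R != 0 :> K by rewrite ((pcharf0P K).1 charK).
apply: (mulfI k0); rewrite flow_coefS.
rewrite (_ : flow_coef (m + l) k = fun j =>
  \sum_(i < k.+1) fps_mul (flow_coef m i) (flow_coef l (k - i)) j); last exact/funext.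
rewrite twisted_der_sum.
pose F i := fps_mul (flow_coef m i) (flow_coef l (k.+1 - i)) n.
transitivity (\sum_(i < k.+1) (i.+1%:R * F i.+1 + (k.+1 - i)%N%:R * F i)).
  apply: eq_bigr => i _; rewrite twisted_derM; congr (_ + _).
    rewrite /F -fps_mulZl subSS; congr (fps_mul _ _ _).
    by apply/funext => j; rewrite flow_coefS.
  rewrite /F -fps_mulZr subSn ?leq_ord //; congr (fps_mul _ _ _).
  by apply/funext => j; rewrite flow_coefS.
rewrite big_split /= mulr_sumr.
(* A zero term extends each sum to all i <= k + 1; the weights i and k + 1 - i of [F i] then add up
   to k + 1. *)
have -> : \sum_(i < k.+1) i.+1%:R * F i.+1 = \sum_(i < k.+2) i%:R * F i.
  by rewrite [RHS]big_ord_recl mul0r add0r.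
have -> : \sum_(i < k.+1) (k.+1 - i)%N%:R * F i =
    \sum_(i < k.+2) (k.+1 - i)%N%:R * F i.
  by rewrite [RHS]big_ord_recr /= subnn mul0r addr0.
rewrite -big_split; apply: eq_bigr => i _ /=.
by rewrite -mulrDl -natrD subnKC // -ltnS.
Qed.

End TwistedDerivation.

(** * Powers of the bracket matrix and integer powers of a unit series *)

Section BracketPowers.
Context {K : fieldType}.
Implicit Types h : fps K.

(** Column m + n of <h> has the entry (m + i) h_(n-i+1) in row m + i, so right multiplication by <h>
    acts on row m as one [twisted_der]. *)
Lemma bimx_exp_bracket h (m : int) k n : h 0%N = 0 ->
  bimx_exp (bracket_mx h) k m (m + n%:Z) =
  iter k (twisted_der (fps_divX h) m) (fps_one K) n.
Proof.
move=> h0; elim: k n => [|k IH] n.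
  rewrite /bimx_exp /= /bimx_one /fps_one; congr (_%:R); congr nat_of_bool.
  by apply/eqP/eqP; lia.
have uh := upper_triangular_bracket h0.
rewrite bimx_expSr // bimx_mulE //; last exact: upper_triangular_exp.
rewrite iterS /twisted_der fps_mulC; apply: eq_bigr => i _.
rewrite IH /bracket_mx mulrCA -mulrA; congr (_ * (_ * _)).
have -> : m + n%:Z - (m + i%:Z) + 1 = (n - i).+1%:Z by have := ltn_ord i; lia.
by [].
Qed.

Lemma bimx_scale_bracket c h :
  bimx_scale c (bracket_mx h) = bracket_mx (fun n => c * h n).
Proof.
apply/funext => m; apply/funext => n; rewrite /bimx_scale /bracket_mx mulrCA.
by case: (n - m + 1) => //= j; rewrite mulr0.
Qed.

(** The recurrence determines [e] upwards from 0, and downwards because [a] is invertible and can be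
    cancelled. *)
Lemma fps_expz_uniq a (e : int -> fps K) : a 0%N != 0 -> e 0 = fps_one K ->
  (forall m, e (m + 1) = fps_mul a (e m)) -> forall m, e m = fps_expz a m.
Proof.
move=> a0 e0 eS; elim/int_ind => [|n IH|n IH]; first by rewrite e0.
  by rewrite -addn1 PoszD eS IH -fps_expzS.
have cancel (x y : fps K) : fps_mul a x = fps_mul a y -> x = y.
  move=> /(congr1 (fps_mul (fps_inv a))); rewrite !fps_mulA.
  by rewrite (fps_mulC _ a) fps_mulfV // !fps_mul1.
apply: cancel; rewrite -eS -fps_expzS //.
by have -> : - n.+1%:Z + 1 = - n%:Z by lia.
Qed.

End BracketPowers.

(** * Bounds for the iterates of D *)

Section FlowBounds.
Context {K : numFieldType}.
Variable g : fps K.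

(** One step enlarges the first N + 1 coefficients by at most a fixed factor. This growth is
    geometric in k, so division by k! gives convergence for every m, but without uniformity in n. *)
Lemma iter_twisted_der_bound (m : int) (N k n : nat) : (n <= N)%N ->
  `|iter k (twisted_der g m) (fps_one K) n| <=
  ((\sum_(i < N.+1) `|g i|) * (\sum_(j < N.+1) `|(m + j%:Z)%:~R : K|)) ^+ k.
Proof.
set G := \sum_(i < N.+1) `|g i|; set W := \sum_(j < N.+1) _.
have W0 : 0 <= W by apply: sumr_ge0.
elim: k n => [|k IH] n nN.
  by rewrite expr0 /= /fps_one normr_nat lern1 leq_b1.
rewrite iterS exprS; apply: le_trans (ler_norm_sum _ _ _) _.
apply: (@le_trans _ _ (\sum_(i < n.+1) `|g i| * (W * (G * W) ^+ k))).
  apply: ler_sum => i _; rewrite !normrM ler_wpM2l //.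
  apply: ler_pM => //; last by apply: IH; lia.
  have lt_j : (n - i < N.+1)%N by lia.
  rewrite /W (bigD1 (Ordinal lt_j)) //= lerDl; exact: sumr_ge0.
rewrite -mulr_suml -mulrA ler_wpM2r //.
  by rewrite mulr_ge0 // exprn_ge0 // mulr_ge0 // sumr_ge0.
rewrite /G (big_ord_widen N.+1 (fun i => `|g i|)) //.
rewrite [leRHS](bigID (fun i : 'I_N.+1 => (i < n.+1)%N)) /=.
by rewrite lerDl sumr_ge0.
Qed.

(** The hockey-stick identity; it sums the convolution with the geometric series in the next
    bound. *)
Lemma sum_bin_diag (n a : nat) : (\sum_(j < n.+1) 'C(j + a, a) = 'C(n + a.+1, a.+1))%N.
Proof.
elim: n => [|n IH]; first by rewrite big_ord1 !add0n !binn.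
by rewrite big_ord_recr /= IH [in RHS]addSn binS -addSnnS.
Qed.

Lemma bin_leq_exp2 (n k : nat) : ('C(n, k) <= 2 ^ n)%N.
Proof.
have [kn|nk] := leqP k n; last by rewrite bin_small.
rewrite -[2%N]/(1 + 1)%N expnDn (bigD1 (inord k)) //= !exp1n inordK //.
by rewrite !muln1 leq_addr.
Qed.

(* (1 - rho z)^-1 d/dz maps (1 - rho z)^-(2 k + 1) to
   (2 k + 1) rho (1 - rho z)^-(2 k + 3); the binomials below are the
   coefficients of these powers. *)
Lemma iter_twisted_der1_bound (M rho : K) k n : 0 <= M -> 0 <= rho ->
  (forall j, `|g j| <= M * rho ^+ j) ->
  `|iter k (twisted_der g 1) (fps_one K) n| <=
  k`!%:R * (2 * M) ^+ k * 'C(n + k.*2, k.*2)%:R * rho ^+ n.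
Proof.
move=> M0 rho0 gM; elim: k n => [|k IH] n.
  rewrite expr0 /= fact0 bin0 !mul1r /fps_one; case: n => [|n].
    by rewrite normr1 expr0.
  by rewrite normr0 exprn_ge0.
rewrite iterS /twisted_der fps_mulC; apply: le_trans (ler_norm_sum _ _ _) _.
set c := k`!%:R * (2 * M) ^+ k.
have c0 : 0 <= c by rewrite mulr_ge0 // exprn_ge0 // mulr_ge0.
apply: (@le_trans _ _ (\sum_(j < n.+1)
    (c * M * rho ^+ n * k.*2.+1%:R) * 'C(j + k.*2.+1, k.*2.+1)%:R)).
  apply: ler_sum => j _; rewrite !normrM.
  have -> : `|(1 + j%:Z)%:~R : K| = j.+1%:R.
    by rewrite -[1 + j%:Z]/(Posz (1 + j)) normr_nat add1n.
  apply: (@le_trans _ _ (j.+1%:R * (c * 'C(j + k.*2, k.*2)%:R * rho ^+ j) *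
      (M * rho ^+ (n - j)))).
    apply: ler_pM => //.
    by rewrite ler_wpM2l ?IH.
  have -> : rho ^+ n = rho ^+ j * rho ^+ (n - j) by rewrite -exprD subnKC // leq_ord.
  have -> : j.+1%:R * (c * 'C(j + k.*2, k.*2)%:R * rho ^+ j) * (M * rho ^+ (n - j)) =
      c * M * (rho ^+ j * rho ^+ (n - j)) * (j.+1 * 'C(j + k.*2, k.*2))%:R.
    by rewrite natrM; ring.
  rewrite -[leRHS]mulrA -natrM ler_wpM2l //.
    by rewrite !(mulr_ge0, exprn_ge0).
  (* The weight j + 1 is enlarged to j + 2 k + 1, which the binomial absorbs at the price of a
     factor 2 k + 1. *)
  rewrite ler_nat -mul_bin_diag addnS /= leq_mul2r; apply/orP; right; lia.
rewrite -mulr_sumr -natr_sum sum_bin_diag doubleS.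
set b := 'C(_, _)%:R.
(* The new factors k + 1 and 2 M supply 2 k + 2, enough to cover 2 k + 1. *)
have -> : k.+1`!%:R * (2 * M) ^+ k.+1 * b * rho ^+ n =
    c * M * rho ^+ n * k.*2.+2%:R * b.
  by rewrite /c factS natrM exprS -doubleS -mul2n natrM; ring.
rewrite ler_wpM2r // ?ler0n // ler_wpM2l ?ler_nat //.
by rewrite !(mulr_ge0, exprn_ge0).
Qed.

(** The binomial is at most 2^(n + 2 k) = 2^n 4^k, which turns 2 M into 8 M and rho into 2 rho. *)
Lemma flow_coef1_bound (M rho : K) k n : 0 <= M -> 0 <= rho ->
  (forall j, `|g j| <= M * rho ^+ j) ->
  `|flow_coef g 1 k n| <= (8 * M) ^+ k * (2 * rho) ^+ n.
Proof.
move=> M0 rho0 gM; rewrite /flow_coef normrM normfV normr_nat.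
have fk : 0 < k`!%:R :> K by rewrite ltr0n fact_gt0.
rewrite mulrC ler_pdivrMr //; apply: le_trans (iter_twisted_der1_bound _ _ k n M0 rho0 gM) _.
have -> : (8 * M) ^+ k * (2 * rho) ^+ n * k`!%:R =
    k`!%:R * (2 * M) ^+ k * (2 ^ (n + k.*2))%N%:R * rho ^+ n.
  rewrite natrX exprD -mul2n exprM (_ : 2 ^+ 2 = 4 :> K); last by ring.
  by rewrite (_ : 8 * M = 4 * (2 * M)) ?[(4 * _) ^+ k]exprMn ?[(2 * rho) ^+ n]exprMn; ring.
rewrite ler_wpM2r ?exprn_ge0 // ler_wpM2l ?ler_nat ?bin_leq_exp2 //.
by rewrite !(mulr_ge0, exprn_ge0).
Qed.

End FlowBounds.

(** * Cauchy products of series dominated by an exponential series *)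

Section CauchyProduct.

Lemma sum_triangle {V : nmodType} (F : nat -> nat -> V) N :
  \sum_(k < N) \sum_(i < k.+1) F i (k - i)%N =
  \sum_(i < N) \sum_(j < N | (i + j < N)%N) F i j.
Proof.
transitivity (\sum_(k < N) \sum_(i < N | (i < k.+1)%N) F i (k - i)%N).
  by apply: eq_bigr => k _; rewrite (big_ord_widen N (fun i => F i (k - i)%N)).
rewrite (exchange_big_dep xpredT) //=; apply: eq_bigr => i _.
rewrite -(big_geq_mkord _ _ xpredT (fun k => F i (k - i)%N)).
rewrite -{1}[nat_of_ord i]add0n big_addn big_mkord.
transitivity (\sum_(j < N - i) F i j); first by apply: eq_bigr => j _; rewrite addnK.
rewrite (big_ord_widen N (F i)) ?leq_subr //; apply: eq_bigl => j.
by rewrite ltn_subRL.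
Qed.

(** The square of index pairs minus the triangle i + j < N leaves the pairs with i + j >= N. *)
Lemma prod_sum_sub_triangle {K : pzRingType} (a b : nat -> K) N :
  (\sum_(i < N) a i) * (\sum_(j < N) b j) -
    \sum_(k < N) \sum_(i < k.+1) a i * b (k - i)%N =
  \sum_(i < N) \sum_(j < N | ~~ (i + j < N)%N) a i * b j.
Proof.
rewrite (sum_triangle (fun i j => a i * b j)) mulr_suml -sumrB.
apply: eq_bigr => i _; rewrite mulr_sumr (bigID (fun j : 'I_N => (i + j < N)%N)) /=.
by rewrite addrAC subrr add0r.
Qed.

Context {R : realType}.

Lemma exp_coeffD (x y : R) k :
  \sum_(i < k.+1) exp_coeff x i * exp_coeff y (k - i)%N = exp_coeff (x + y) k.
Proof.
rewrite /exp_coeff /= [x + y]addrC exprDn mulr_suml; apply: eq_bigr => i _.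
rewrite -mulr_natr -(bin_fact (leq_ord i)) !natrM.
have f0 j : j`!%:R != 0 :> R by rewrite pnatr_eq0 -lt0n fact_gt0.
have C0 : 'C(k, i)%:R != 0 :> R by rewrite pnatr_eq0 -lt0n bin_gt0 leq_ord.
by field; rewrite !f0 C0.
Qed.

(** The error of the Cauchy product is dominated termwise by the same error for the exponential
    series at c, and that one tends to exp(c)^2 - exp(2 c) = 0. *)
Lemma cvg_series_cauchy_product (u v : nat -> R[i]^o) (a b : R[i]^o) (c : R) :
  (forall k, `|u k| <= (exp_coeff c k)%:C) ->
  (forall k, `|v k| <= (exp_coeff c k)%:C) ->
  series u @ \oo --> a -> series v @ \oo --> b ->
  series (fun k => \sum_(i < k.+1) u i * v (k - i)%N : R[i]^o) @ \oo --> (a * b : R[i]^o).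
Proof.
move=> uc vc ua vb.
pose tail N : R := series (exp_coeff c) N * series (exp_coeff c) N - series (exp_coeff (c + c)) N.
have tail0 : tail @ \oo --> (0 : R).
  have cE (x : R) : series (exp_coeff x) @ \oo --> expR x by exact: is_cvg_series_exp_coeff.
  by rewrite -(subrr (expR (c + c))) {1}expRD; apply: cvgB; [apply: cvgM|].
pose d N : R[i]^o := series u N * series v N -
  series (fun k => \sum_(i < k.+1) u i * v (k - i)%N : R[i]^o) N.
have d_le N : `|d N| <= (tail N)%:C.
  rewrite /d /tail /series /= !big_mkord prod_sum_sub_triangle.
  under [X in _ - X]eq_bigr do rewrite -exp_coeffD.
  rewrite prod_sum_sub_triangle rmorph_sum; apply: le_trans (ler_norm_sum _ _ _) _.
  apply: ler_sum => i _; rewrite rmorph_sum; apply: le_trans (ler_norm_sum _ _ _) _.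
  by apply: ler_sum => j _; rewrite normrM rmorphM; apply: ler_pM.
have d0 : d @ \oo --> (0 : R[i]^o).
  apply/cvgrPdist_lt => /= e; case: e => e e'; rewrite ltcE /= => /andP[/eqP -> e0].
  near=> N; rewrite sub0r normrN; apply: le_lt_trans (d_le N) _.
  rewrite ltcR; apply: le_lt_trans (ler_norm _) _; rewrite -normrN -sub0r.
  by near: N; move/cvgrPdist_lt : tail0; apply.
have -> : series (fun k => \sum_(i < k.+1) u i * v (k - i)%N : R[i]^o) =
    (fun N => series u N * series v N - d N).
  by apply/funext => N; rewrite /d subKr.
have uv_ab : (fun N => series u N * series v N : R[i]^o) @ \oo --> (a * b : R[i]^o).
  exact: (@cvgM R[i] nat \oo _ (series u) (series v) a b ua vb).
by have := @cvgB R[i] R[i]^o nat \oo _ _ _ _ _ uv_ab d0; rewrite subr0 => ab; exact: ab.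
Unshelve. all: by end_near.
Qed.

End CauchyProduct.

(** * Holomorphy as geometric growth of the coefficients *)

Section HolomorphicSeries.
Context {R : realType}.
Implicit Types a : fps R[i].

Lemma complex_normE (z : R[i]) : `|z| = (complex.Re `|z|)%:C.
Proof. by rewrite normc_def. Qed.

Lemma complex_norm_lim_le (u : nat -> R[i]^o) (l : R[i]^o) (B : R) :
  u @ \oo --> l -> (forall n, `|u n| <= B%:C) -> `|l| <= B%:C.
Proof.
move=> ul uB; rewrite complex_normE lecR; apply/ler_addgt0Pr => e e0.
have /cvgrPdist_lt/(_ e%:C) := ul; rewrite ltcR => /(_ e0) [N _ /(_ N (leqnn N)) lN].
rewrite -lecR -complex_normE -(subrK (u N) l) addrC rmorphD.
by apply: le_trans (ler_normD _ _) _; apply: lerD; [exact: uB|exact: ltW].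
Qed.

Lemma holomorphic_fps_bound a : holomorphic_fps a ->
  exists M rho : R, [/\ 0 < M, 0 < rho & forall n, `|a n| <= M%:C * rho%:C ^+ n].
Proof.
case=> r r0 cv; pose s : R := r / 2.
have s0 : 0 < s by rewrite divr_gt0.
have sr : `|s%:C| < r%:C.
  rewrite ger0_norm ?lecR ?ltW // ltcR /s ltr_pdivrMr // mulr2n mulrDr mulr1.
  by rewrite ltrDl.
have /cvg_series_cvg_0 /cvgrPdist_lt /(_ 1 ltr01) [N _ small] := cv _ sr.
have c_ge0 n : 0 <= complex.Re `|a n * s%:C ^+ n|.
  by rewrite -lecR -complex_normE; exact: normr_ge0.
(* The terms at s tend to 0: the summand 1 bounds those from N on, the finite sum bounds the
   others. *)
pose M := 1 + \sum_(n < N) complex.Re `|a n * s%:C ^+ n|.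
have M1 : 1 <= M by rewrite lerDl sumr_ge0.
exists M, s^-1; split; rewrite ?invr_gt0 ?(lt_le_trans ltr01 M1) // => n.
have sn0 : 0 < `|s%:C ^+ n| by rewrite normr_gt0 expf_neq0 // fmorph_eq0 gt_eqF.
have -> : M%:C * (s^-1)%:C ^+ n = M%:C / `|s%:C ^+ n|.
  by rewrite normrX ger0_norm ?lecR ?ltW // fmorphV exprVn.
rewrite ler_pdivlMr // -normrM.
have [Nn|nN] := leqP N n.
  apply: (@le_trans _ _ 1); last by rewrite lecR.
  by have := small n Nn; rewrite /= sub0r normrN => /ltW.
rewrite complex_normE lecR /M (bigD1 (Ordinal nN)) //= addrCA lerDl.
by apply: addr_ge0 => //; apply: sumr_ge0 => i _; exact: c_ge0.
Qed.

Lemma holomorphic_fps_of_bound a (M rho : R) : 0 < rho ->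
  (forall n, `|a n| <= M%:C * rho%:C ^+ n) -> holomorphic_fps a.
Proof.
move=> rho0 aM; exists (2 * rho)^-1; first by rewrite invr_gt0 mulr_gt0.
move=> z zr; apply: (@cvg_series_complex _ _ (geometric M (2^-1))); last first.
  by apply: is_cvg_geometric_series; rewrite ger0_norm ?invr_ge0 // invf_lt1 ?ltr1n.
move=> n; rewrite normrM normrX /geometric /= rmorphM rmorphXn /=.
have M0 : 0 <= M%:C by have := aM 0%N; rewrite expr0 mulr1; exact: le_trans.
apply: (@le_trans _ _ (M%:C * rho%:C ^+ n * ((2 * rho)^-1)%:C ^+ n)).
  apply: ler_pM => //; rewrite ?exprn_ge0 // lerXn2r ?nnegrE //; last exact: ltW.
  exact: le_trans (normr_ge0 z) (ltW zr).
rewrite -mulrA -exprMn -rmorphM.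
by rewrite invfM mulrCA divff ?mulr1 // gt_eqF.
Qed.

End HolomorphicSeries.

Section ExponentialOfBracket.
Context {R : realType}.
Variable h : fps R[i].
Hypothesis h0 : h 0%N = 0.
Let g := fps_divX h.

Definition flow_series (m : int) (n : nat) : nat -> R[i]^o :=
  series (fun k => flow_coef g m k n : R[i]^o).

Definition flow (m : int) : fps R[i] := fun n => limn (flow_series m n).

Lemma flow_coef_bound (m : int) (N : nat) : exists c : R,
  forall k n, (n <= N)%N -> `|flow_coef g m k n| <= (exp_coeff c k)%:C.
Proof.
pose c := (\sum_(i < N.+1) `|g i|) * (\sum_(j < N.+1) `|(m + j%:Z)%:~R : R[i]|).
have cE : (complex.Re `|c|)%:C = c.
  by rewrite -complex_normE ger0_norm // mulr_ge0 // sumr_ge0.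
exists (complex.Re `|c|) => k n nN.
rewrite /exp_coeff /= rmorphM rmorphXn /= cE normrM normfV normr_nat fmorphV rmorph_nat.
by rewrite mulrC ler_wpM2r ?invr_ge0 // iter_twisted_der_bound.
Qed.

Lemma cvg_flow_series m n : flow_series m n @ \oo --> (flow m n : R[i]^o).
Proof.
have [c cP] := flow_coef_bound m n.
apply: (@cvg_series_complex _ _ (exp_coeff c)); last exact: is_cvg_series_exp_coeff.
by move=> k; exact: cP.
Qed.

Lemma flow_add m l : flow (m + l) = fps_mul (flow m) (flow l).
Proof.
apply/funext => n.
have [c1 c1P] := flow_coef_bound m n; have [c2 c2P] := flow_coef_bound l n.
pose c := Num.max `|c1| `|c2|.
have cP m' c' : (forall k j, (j <= n)%N -> `|flow_coef g m' k j| <= (exp_coeff c' k)%:C) ->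
    `|c'| <= c -> forall k j, (j <= n)%N -> `|flow_coef g m' k j| <= (exp_coeff c k)%:C.
  move=> c'P c'c k j jn; apply: le_trans (c'P k j jn) _; rewrite lecR /exp_coeff /=.
  rewrite ler_wpM2r ?invr_ge0 //; apply: le_trans (ler_norm _) _.
  by rewrite normrX lerXn2r ?nnegrE // (le_trans _ c'c).
have /(cP _ _ c1P) {}c1P : `|c1| <= c by rewrite le_max lexx.
have /(cP _ _ c2P) {}c2P : `|c2| <= c by rewrite le_max lexx orbT.
pose w (i : 'I_n.+1) : nat -> R[i]^o := series (fun k =>
  \sum_(p < k.+1) flow_coef g m p i * flow_coef g l (k - p) (n - i)%N : R[i]^o).
have conv i : w i @ \oo --> (flow m i * flow l (n - i)%N : R[i]^o).
  apply: (cvg_series_cauchy_product (fun k => flow_coef g m k i)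
    (fun k => flow_coef g l k (n - i)%N) _ _ c).
  - by move=> k; apply: c1P; rewrite leq_ord.
  - by move=> k; apply: c2P; rewrite leq_subr.
  - exact: cvg_flow_series.
  - exact: cvg_flow_series.
have rhs : flow_series (m + l) n @ \oo --> (fps_mul (flow m) (flow l) n : R[i]^o).
  have -> : flow_series (m + l) n = fun N => \sum_(i < n.+1) w i N.
    apply/funext => N; rewrite /flow_series /w /series /= exchange_big /=.
    apply: eq_bigr => k _; rewrite flow_coefD; last exact: Num.Theory.pchar_num.
    by rewrite /fps_mul exchange_big.
  exact: (@cvg_big R[i]^o _ (@GRing.add R[i]^o) 0 xpredT (@add_continuous R[i]^o)
    nat \oo (index_enum _) w _ _ (fun i _ => conv i)).
exact: (cvg_lim (@norm_hausdorff _ R[i]^o) rhs).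
Qed.

Lemma flow0 : flow 0 = fps_one R[i].
Proof.
apply/funext => n; apply: (cvg_lim (@norm_hausdorff _ R[i]^o)).
rewrite -cvg_shiftS.
have -> : (fun N => flow_series 0 n N.+1) = fun=> fps_one R[i] n.
  apply/funext => N; rewrite /flow_series /series /= big_nat_recl //.
  rewrite flow_coef0 big1 ?addr0 // => k _.
  by rewrite flow_coef0.
exact: cvg_cst.
Qed.

Lemma flow1_unit : flow 1 0%N != 0.
Proof.
have := congr1 (fun a => a 0%N) (flow_add 1 (-1)).
rewrite subrr flow0 /fps_mul big_ord1 /fps_one /= => e; apply/eqP => f0.
by move: e; rewrite f0 mul0r => /eqP; rewrite oner_eq0.
Qed.

Lemma bimx_expm_bracket :
  bimx_expm (bracket_mx h) = power_mx (fun n => if n is n'.+1 then flow 1 n' else 0).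
Proof.
apply/funext => m; apply/funext => p; rewrite /bimx_expm /bimx_expm_series.
have [pm|mp] := ltP p m.
  rewrite upper_triangular_power //.
  rewrite (_ : series _ = fun=> 0); last first.
    apply/funext => N; rewrite /series /= big1 // => k _.
    by rewrite upper_triangular_exp ?mulr0 //; exact: upper_triangular_bracket.
  exact: (cvg_lim (@norm_hausdorff _ R[i]^o) (cvg_cst _)).
have [n ->] : exists n : nat, p = m + n%:Z by exists (absz (p - m)%R); lia.
rewrite /power_mx addrAC subrr add0r /= -(@fps_expz_uniq _ _ flow).
- have -> : (fun k => (k`!%:R)^-1 * bimx_exp (bracket_mx h) k m (m + n%:Z)) =
      (fun k => flow_coef g m k n) by apply/funext => k; rewrite bimx_exp_bracket.
  by [].
- exact: flow1_unit.
- exact: flow0.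
- by move=> l; rewrite addrC flow_add.
Qed.

Lemma flow1_bound (M rho : R) : 0 <= M -> 16 * M <= 1 -> 0 <= rho ->
  (forall n, `|g n| <= M%:C * rho%:C ^+ n) ->
  forall n, `|flow 1 n| <= 2%:C * (2 * rho)%:C ^+ n.
Proof.
move=> M0 M16 rho0 gM n.
rewrite -rmorphXn -rmorphM; apply: (complex_norm_lim_le _ _ _ (cvg_flow_series 1 n)) => N.
apply: (@le_trans _ _ ((2 * rho) ^+ n * series (geometric 1 (2^-1)) N)%:C); last first.
  rewrite lecR mulrC ler_wpM2r ?exprn_ge0 ?mulr_ge0 //.
  rewrite geometric_seriesE ?mul1r; last by rewrite lt_eqF // invf_lt1 ?ltr1n.
  have -> : 1 - 2^-1 = 2^-1 :> R by field.
  by rewrite invrK ler_piMl // lerBlDr lerDl exprn_ge0 // invr_ge0.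
rewrite /flow_series /series /= mulr_sumr rmorph_sum.
apply: le_trans (ler_norm_sum _ _ _) _; apply: ler_sum => k _.
apply: le_trans (flow_coef1_bound _ M%:C rho%:C _ _ _ _ gM) _; rewrite ?lecR //.
have -> : (8 * M%:C) ^+ k * (2 * rho%:C) ^+ n = ((8 * M) ^+ k * (2 * rho) ^+ n)%:C.
  by rewrite rmorphM !rmorphXn !rmorphM !rmorph_nat.
rewrite lecR mulrC ler_wpM2l ?exprn_ge0 ?mulr_ge0 // mul1r.
rewrite lerXn2r ?nnegrE ?mulr_ge0 ?invr_ge0 //.
by rewrite -[2^-1]mul1r ler_pdivlMr // mulrAC -natrM.
Qed.

End ExponentialOfBracket.

Theorem corollary4p12 (R : realType) (H : bimx R[i]) (hH : mA0 H) :
  exists2 T : R, 0 < T &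
    forall t : R, 0 <= t < T -> MA0 (bimx_expm (bimx_scale t%:C H)).
Proof.
case: hH => h [h0 /holomorphic_fps_bound[M [rho [M0 rho0 hM]]] ->].
have D0 : 0 < 16 * (M * rho) by rewrite !mulr_gt0.
exists (16 * (M * rho))^-1; first by rewrite invr_gt0.
move=> t /andP[t0 tT]; rewrite bimx_scale_bracket.
set th := fun n => t%:C * h n.
have th0 : th 0%N = 0 by rewrite /th h0 mulr0.
have f_bound n : `|flow th 1 n| <= 2%:C * (2 * rho)%:C ^+ n.
  apply: (@flow1_bound _ _ (t * (M * rho))) => //.
  - by rewrite !mulr_ge0 // ltW.
  - by rewrite mulrCA -ler_pdivlMr // div1r ltW.
  - exact: ltW.
  move=> j; rewrite /fps_divX /th normrM ger0_norm ?lecR // !rmorphM -!mulrA ler_wpM2l ?lecR //.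
  by rewrite -exprS.
exists (fun n => if n is n'.+1 then flow th 1 n' else 0); split => //.
- exact: flow1_unit.
- apply: (@holomorphic_fps_of_bound _ _ rho^-1 (2 * rho)); first by rewrite mulr_gt0.
  case=> [|n]; first by rewrite normr0 expr0 mulr1 lecR invr_ge0 ltW.
  rewrite exprS mulrA -rmorphM mulrCA mulVf ?mulr1; last by rewrite gt_eqF.
  exact: f_bound.
- exact: bimx_expm_bracket.
Qed.
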